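(* Let $G$ be a finite simple connected graph. Then $G$ has a proper colouring with exactly $\chi(G)$ colours for which the number of vertices yielding a rainbow neighbourhood attains a unique (hence constant, depending only on $G$) maximum value $r^+_\chi(G)$ over all proper colourings of $G$ with exactly $\chi(G)$ colours.
   Context: A minimum proper colouring of a graph $G$ is a proper vertex colouring using exactly $\chi(G)$ colours, where $\chi(G)$ is the chromatic number. Given such a colouring, a vertex $v$ yields a rainbow neighbourhood if its closed neighbourhood $N[v]$ contains at least one vertex of each of the $\chi(G)$ colours. For a given minimum proper colouring, $r_\chi(G)$ is the number of vertices of $G$ yielding a rainbow neighbourhood, and $r^+_\chi(G)$ is the maximum of $r_\chi(G)$ over all minimum proper colourings of $G$. *)

(* Defs.v *)
From mathcomp Require Import all_boot.
Set Implicit Arguments.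
Unset Strict Implicit.
Unset Printing Implicit Defensive.

Record sgraph := SGraph {
  vertex :> finType;
  adj : rel vertex;
  adj_sym : symmetric adj;
  adj_irrefl : irreflexive adj }.

(* The graph without vertices is not counted as connected. *)
Definition connected_graph (G : sgraph) : Prop :=
  0 < #|G| /\ forall x y : G, connect (@adj G) x y.

Definition closed_nbhd (G : sgraph) (v : G) : {set G} :=
  [set u | (u == v) || adj v u].

Definition proper (G : sgraph) (k : nat) (f : {ffun G -> 'I_k}) : bool :=
  [forall u, forall v, adj u v ==> (f u != f v)].

Definition colourable (G : sgraph) (k : nat) : bool :=
  [exists f : {ffun G -> 'I_k}, proper f].

Lemma ex_colourable (G : sgraph) : exists k, colourable G k.
Proof.
exists #|G|; apply/existsP; exists [ffun v => enum_rank v].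
apply/'forall_forallP=> u v; apply/implyP; rewrite !ffunE.
by apply: contraTneq => /enum_rank_inj->; rewrite adj_irrefl.
Qed.

Definition chi (G : sgraph) : nat := ex_minn (ex_colourable G).

(* The palette is 'I_(chi G), and every colour of it has to be used. *)
Definition minimum_colouring (G : sgraph) (f : {ffun G -> 'I_(chi G)}) : bool :=
  proper f && (#|f @: [set: G]| == chi G).

Definition yields_rainbow (G : sgraph) (k : nat) (f : {ffun G -> 'I_k})
    (v : G) : bool :=
  [forall c : 'I_k, exists u in closed_nbhd v, f u == c].

Definition rainbow_number (G : sgraph) (k : nat) (f : {ffun G -> 'I_k}) : nat :=
  #|[set v | yields_rainbow f v]|.

Definition rainbow_max (G : sgraph) : nat :=
  \max_(f : {ffun G -> 'I_(chi G)} | minimum_colouring f) rainbow_number f.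

(* \max over an empty family is 0; this predicate also requires that the
   value be attained. *)
Definition is_max_rainbow (G : sgraph) (m : nat) : Prop :=
  (exists2 f : {ffun G -> 'I_(chi G)},
     minimum_colouring f & rainbow_number f = m) /\
  (forall g : {ffun G -> 'I_(chi G)},
     minimum_colouring g -> rainbow_number g <= m).

(* Main.v *)
Require Import Defs.
From mathcomp Require Import all_boot.

(** The maximum is taken over a finite set of colourings, so it is attained,
    and is unique by antisymmetry of the order, as soon as this set is nonempty.
    Nonemptiness is the only graph-theoretic point: a proper colouring with a
    palette of [chi G] colours exists by definition of [chi], and it uses all of
    them, because deleting the unused colours from the palette gives a proper
    colouring with as many colours as were used
    ([colourable_card_image]), which cannot be fewer than [chi G]. *)

Lemma chi_colourable (G : sgraph) : colourable G (chi G).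
Proof. by rewrite /chi; case: ex_minnP. Qed.

Lemma chi_min (G : sgraph) (k : nat) : colourable G k -> chi G <= k.
Proof. by rewrite /chi; case: ex_minnP => m _; apply. Qed.

(** Renumbering the used colours by their rank is injective on them, so
    adjacent vertices still get different colours. *)
Lemma colourable_card_image (G : sgraph) (k : nat) (f : {ffun G -> 'I_k}) :
  Defs.proper f -> colourable G #|f @: [set: G]|.
Proof.
move=> /'forall_forallP fP.
have im v : f v \in f @: [set: G] by apply: imset_f; rewrite in_setT.
apply/existsP; exists [ffun v => enum_rank_in (im v) (f v)].
apply/'forall_forallP=> u v; apply/implyP=> /(implyP (fP u v)); rewrite !ffunE.
by apply: contra_neq => /(congr1 enum_val); rewrite !enum_rankK_in.
Qed.

Lemma proper_minimum_colouring (G : sgraph) (f : {ffun G -> 'I_(chi G)}) :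
  Defs.proper f -> minimum_colouring f.
Proof.
move=> f_proper; rewrite /minimum_colouring f_proper eqn_leq /=.
rewrite chi_min ?colourable_card_image // andbT.
by rewrite -[leqRHS]card_ord max_card.
Qed.

Lemma ex_minimum_colouring (G : sgraph) :
  exists f : {ffun G -> 'I_(chi G)}, minimum_colouring f.
Proof.
have /existsP[f f_proper] := chi_colourable G.
by exists f; apply: proper_minimum_colouring.
Qed.

Lemma is_max_rainbow_inj (G : sgraph) (m n : nat) :
  is_max_rainbow G m -> is_max_rainbow G n -> m = n.
Proof.
move=> [[f f_min <-] ub_f] [[g g_min <-] ub_g].
by apply/eqP; rewrite eqn_leq ub_g // ub_f.
Qed.

Theorem theorem2p2 (G : sgraph) (hG : connected_graph G) :
  exists f : {ffun G -> 'I_(chi G)},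
    [/\ minimum_colouring f,
        rainbow_number f = rainbow_max G
      & unique (is_max_rainbow G) (rainbow_max G)].
Proof.
have [f0 f0_min] := ex_minimum_colouring G.
have ne : 0 < #|@minimum_colouring G| by apply/card_gt0P; exists f0.
have [f f_min f_max] := eq_bigmax_cond (@rainbow_number G (chi G)) ne.
have max_is_max : is_max_rainbow G (rainbow_max G).
  split; first by exists f.
  by move=> g g_min; apply: leq_bigmax_cond.
exists f; split=> //; split=> // m.
exact: is_max_rainbow_inj.
Qed.
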